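(* Let $\Gamma=(X,R)$ be a bipartite distance-regular graph with diameter $D\ge 4$, valency $k\ge 3$ and eigenvalues $\theta_0>\theta_1>\cdots>\theta_D$. Put $d=\lfloor D/2\rfloor$, fix $x\in X$ and let $T=T(x)$. Choose $n\in\{1,d\}$ if $D$ is odd, and let $n=1$ if $D$ is even. Let $W$ be a thin irreducible $T$-module with endpoint $2$ and local eigenvalue $\tilde\theta_n=-1-\dfrac{b_2b_3}{\theta_n^2-b_2}$. Let $v$ be a nonzero vector in $E_2^*W$. Then the vectors $E_{i+2}^*A_iv$ $(0\le i\le D-4)$ form a basis for $W$.
   Context: Graphs are finite, undirected, connected, without loops or multiple edges; $\partial$ denotes path-length distance. A graph $\Gamma=(X,R)$ of diameter $D$ is distance-regular if for all $0\le h,i,j\le D$ and all $x,y\in X$ with $\partial(x,y)=h$ the number $p^h_{ij}=|\{z\in X:\partial(x,z)=i,\ \partial(z,y)=j\}|$ depends only on $h,i,j$. Write $c_i=p^i_{1,i-1}$, $b_i=p^i_{1,i+1}$, $k=b_0$ (the valency). $\Gamma$ is bipartite if $X$ can be partitioned into two subsets neither of which contains an edge. For $0\le i\le D$, $A_i\in\mathrm{Mat}_X(\mathbb C)$ is the $i$th distance matrix: its $(y,z)$ entry is $1$ if $\partial(y,z)=i$ and $0$ otherwise; $A=A_1$ is the adjacency matrix. The distinct eigenvalues of $A$ are $\theta_0>\cdots>\theta_D$ (real). For bipartite $\Gamma$ with $D\ge4$, $\theta_1^2>b_2>\theta_d^2$. Let $V=\mathbb C^X$. For fixed $x\in X$,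 $E_i^*=E_i^*(x)$ is the diagonal matrix in $\mathrm{Mat}_X(\mathbb C)$ with $(y,y)$ entry $1$ if $\partial(x,y)=i$ and $0$ otherwise. $T=T(x)$ is the subalgebra of $\mathrm{Mat}_X(\mathbb C)$ generated by $A,E_0^*,\ldots,E_D^*$. A $T$-module is a subspace $W\subseteq V$ with $BW\subseteq W$ for all $B\in T$; it is irreducible if it is nonzero and contains no $T$-modules other than $0$ and $W$. The endpoint of an irreducible $W$ is $\min\{i:E_i^*W\ne0\}$; $W$ is thin if $\dim E_i^*W\le1$ for $0\le i\le D$. If $W$ is thin irreducible with endpoint $2$, then $E_2^*W$ is a one-dimensional eigenspace for $E_2^*A_2E_2^*$; the corresponding eigenvalue is called the local eigenvalue of $W$. *)

(* Defs.v *)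
From HB Require Import structures.
From mathcomp Require Import all_boot all_order all_algebra.
From mathcomp Require Export complex.
From mathcomp Require Export reals.

Set Implicit Arguments.
Unset Strict Implicit.
Unset Printing Implicit Defensive.

Import Order.TTheory GRing.Theory Num.Theory.
Local Open Scope ring_scope.

Section Graph.
Variables (X : finType) (e : rel X).

Definition simple_graph : Prop := symmetric e /\ irreflexive e.

Definition connected_graph : Prop := forall y z : X, connect e y z.

(* [iota 0 #|X|] enumerates 0, ..., #|X| - 1 and a shortest path visits no
   vertex twice, so this is the path-length distance whenever z can be reached
   from y; otherwise the value is #|X|. *)
Definition gdist (y z : X) : nat :=
  find (fun n => [exists p : n.-tuple X, path e y p && (last y p == z)])
       (iota 0 #|X|).

Definition diameter : nat := (\max_(y : X) \max_(z : X) gdist y z)%N.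

Definition bipartite : Prop :=
  exists S : {set X},
    (forall y z : X, y \in S -> z \in S -> ~~ e y z) /\
    (forall y z : X, y \notin S -> z \notin S -> ~~ e y z).

Definition pcount (i j : nat) (y z : X) : nat :=
  #|[set w | (gdist y w == i) && (gdist w z == j)]|.

Definition distance_regular : Prop :=
  forall h i j : nat, (h <= diameter)%N -> (i <= diameter)%N ->
    (j <= diameter)%N ->
  forall y z y' z' : X, gdist y z = h -> gdist y' z' = h ->
    pcount i j y z = pcount i j y' z'.

(* p^h_{ij}, read off at an arbitrary pair at distance h; in a
   distance-regular graph the choice of the pair is immaterial. *)
Definition pnum (h i j : nat) : nat :=
  if [pick yz : X * X | gdist yz.1 yz.2 == h] is Some yz
  then pcount i j yz.1 yz.2 else 0%N.

Definition bnum (i : nat) : nat := pnum i 1 i.+1.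

Definition valency : nat := bnum 0.

End Graph.

(* Rows and columns of a matrix in Mat_X(C) are indexed by X through
   [enum_val : 'I_#|X| -> X]; matrices act on columns, V = 'cV[C]_#|X|. *)
Section Terwilliger.
Variables (C : fieldType) (X : finType) (e : rel X).

Definition dist_mx (i : nat) : 'M[C]_#|X| :=
  \matrix_(r, s) (gdist e (enum_val r) (enum_val s) == i)%:R.

Definition adj_mx : 'M[C]_#|X| := dist_mx 1.

Variable x : X.

Definition Estar (i : nat) : 'M[C]_#|X| :=
  \matrix_(r, s) ((r == s) && (gdist e x (enum_val r) == i))%:R.

(* membership in T(x) *)
Inductive Talg : 'M[C]_#|X| -> Prop :=
  | Talg_adj : Talg adj_mx
  | Talg_Estar (i : nat) : (i <= diameter e)%N -> Talg (Estar i)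
  | Talg_scalar (a : C) : Talg a%:M
  | Talg_add (M N : 'M[C]_#|X|) : Talg M -> Talg N -> Talg (M + N)
  | Talg_mul (M N : 'M[C]_#|X|) : Talg M -> Talg N -> Talg (M *m N).

Definition Tmodule (W : {vspace 'cV[C]_#|X|}) : Prop :=
  forall B : 'M[C]_#|X|, Talg B ->
  forall w : 'cV[C]_#|X|, w \in W -> B *m w \in W.

Definition irreducible_Tmodule (W : {vspace 'cV[C]_#|X|}) : Prop :=
  [/\ Tmodule W, W <> 0%VS
    & forall U : {vspace 'cV[C]_#|X|}, Tmodule U -> (U <= W)%VS ->
        U = 0%VS \/ U = W].

(* the subspace E_i^* W *)
Definition EstarW (i : nat) (W : {vspace 'cV[C]_#|X|})
    : {vspace 'cV[C]_#|X|} :=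
  (linfun (mulmx (Estar i)) @: W)%VS.

Definition has_endpoint (W : {vspace 'cV[C]_#|X|}) (r : nat) : Prop :=
  [/\ (r <= diameter e)%N, EstarW r W <> 0%VS
    & forall i : nat, (i < r)%N -> EstarW i W = 0%VS].

Definition thin (W : {vspace 'cV[C]_#|X|}) : Prop :=
  forall i : nat, (i <= diameter e)%N -> (\dim (EstarW i W) <= 1)%N.

(* Meaningful for W thin irreducible with endpoint 2, where E_2^* W is
   one-dimensional and eta is uniquely determined. *)
Definition local_eigenvalue (W : {vspace 'cV[C]_#|X|}) (eta : C) : Prop :=
  forall w : 'cV[C]_#|X|, w \in EstarW 2 W ->
    (Estar 2 *m dist_mx 2 *m Estar 2) *m w = eta *: w.

End Terwilliger.

Arguments dist_mx C [X] e i.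
Arguments adj_mx C [X] e.
Arguments Estar C [X] e x i.

(* theta 0 > ... > theta m are exactly the distinct eigenvalues of M *)
Definition ordered_eigenvalues (R : realType) (n : nat) (M : 'M[R[i]]_n)
    (m : nat) (theta : nat -> R) : Prop :=
  (forall i j : nat, (i < j)%N -> (j <= m)%N -> theta j < theta i) /\
  (forall a : R[i], eigenvalue M a <->
     exists2 i : nat, (i <= m)%N & a = (theta i)%:C%C).

(* Main.v *)
Require Import Defs.
From mathcomp Require Import all_boot all_order all_algebra.
From mathcomp Require Import reals complex zify ring lra.

Set Implicit Arguments.
Unset Strict Implicit.
Unset Printing Implicit Defensive.

Import Order.TTheory GRing.Theory Num.Theory.
Local Open Scope ring_scope.

(** The point is that [W] has dimension exactly [D - 3]. By thinness and
    bipartiteness, [W] is spanned by [v] and the vectors obtained from it by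
    applying [A] and keeping only the part one step farther from [x]
    ([raised_span]). A path that leaves the second subconstituent and moves away
    from [x] at each of its [i] steps is a geodesic, so the [i]-th of these
    vectors is [c_1 ... c_i] times [E_(i+2)^* A_i v] ([raised_distance_vec]).
    They have disjoint supports; hence the claim holds as soon as they are
    nonzero for [i <= D - 4], which amounts to [dim W = D - 3].

    The dimension is read off the eigenvalues of [A] on [W]. Since [W] is
    generated by [v] under [A], it is spanned by the nonzero vectors among the
    [E_j v], where [E_j] is the projection onto the [theta_j]-eigenspace
    ([module_eigenbasis]). The matrix [E_j] is a polynomial in [A], so its
    [(y, z)] entry is a function [f_j] of the distance from [y] to [z]. Two
    vertices at distance 2 from [x] are at distance 0, 2 or 4, the entries of
    [v] sum to 0, and the local eigenvalue describes the action of [A_2] on [v];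
    therefore [E_2^* E_j v] is an explicit multiple of [v] ([Estar_proj]), and
    [E_j v = 0] if and only if the multiplier vanishes. The recurrence of the
    [f_j] turns the multiplier into a positive number times
    [(k^2 - theta_j^2) (theta_n^2 - theta_j^2) / (theta_n^2 - b_2)]
    ([local_ratio_eq0]), so exactly the four indices [0], [D], [n] and [D - n]
    are lost, the last two because [theta_(D - i) = - theta_i].

    It remains to see that [theta_n^2 <> b_2]. The [E_j] add up to the identity,
    whose entries at distances 2 and 4 are zero, and this says that [b_2] is a
    weighted mean of the numbers [theta_j^2] with [0 < j < D]
    ([sum_proj_theta]). An extreme value equals a mean only when all values
    agree, and three of them never do ([theta_sq_neq_b2]). *)

(** * Spectral projections of a normal matrix *)
Section SpectralProjections.
Variables (C : numClosedFieldType) (N : nat) (A : 'M[C]_N).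
Variables (m : nat) (t : nat -> C).
Hypothesis normalA : A \is normalmx.
Hypothesis inj_t : {in gtn m.+1 &, injective t}.
Hypothesis eig_t : forall a,
  eigenvalue A a <-> exists2 i : nat, (i <= m)%N & a = t i.

(** The Lagrange interpolation polynomial at [t j], evaluated at [A]. In this form
    whatever is stable under [A] and linear combinations is stable under the
    projection. *)
Definition eigenproj (j : nat) : 'M[C]_N :=
  \prod_(l < m.+1 | l != j :> nat) ((t j - t l)^-1 *: (A - (t l)%:M)).

Lemma eigenproj_ind (P : 'M[C]_N -> Prop) :
    P 1%:M ->
    (forall j l M, P M -> P ((t j - t l)^-1 *: (A *m M - t l *: M))) ->
  forall j, P (eigenproj j).
Proof.
move=> P1 PS j; rewrite /eigenproj; elim/big_rec: _ => // l M _ PM.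
rewrite -[_ * _]/(_ *m _) -scalemxAl mulmxBl mul_scalar_mx; exact: PS.
Qed.

(* [phi f] is the value of the function [f] in a fixed eigenbasis of [A]; all the
   properties of the projections are pointwise identities between such
   functions. *)
Let P := spectralmx A.
Let sp := spectral_diag A.
Let diagA : A = invmx P *m diag_mx sp *m P.
Proof. exact/orthomx_spectralP. Qed.
Let P_unit : P \in unitmx. Proof. exact: spectral_unit. Qed.
Let phi (f : 'I_N -> C) := invmx P *m diag_mx (\row_r f r) *m P.

Let phiM f g : phi f *m phi g = phi (fun r => f r * g r).
Proof.
rewrite /phi !mulmxA mulmxK // -(mulmxA _ (diag_mx _) (diag_mx _)) mulmx_diag.
by congr (_ *m diag_mx _ *m _); apply/rowP=> i; rewrite !mxE.
Qed.

Let eq_phi f g : f =1 g -> phi f = phi g.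
Proof.
by move=> fg; congr (_ *m diag_mx _ *m _); apply/rowP=> i; rewrite !mxE.
Qed.

Let phiC a : a%:M = phi (fun=> a).
Proof.
rewrite /phi (_ : \row_r _ = const_mx a); last by apply/rowP=> i; rewrite !mxE.
by rewrite diag_const_mx mul_mx_scalar -scalemxAl mulVmx // scalemx1.
Qed.

Let phi1 : phi (fun=> 1) = 1. Proof. by rewrite -phiC. Qed.

Let phiZB c f g : c *: (phi f - phi g) = phi (fun r => c * (f r - g r)).
Proof.
rewrite /phi -mulmxBl -mulmxBr scalemxAl scalemxAr; congr (_ *m _ *m _).
by apply/matrixP=> i j; rewrite !mxE -mulrnBl mulrnAr.
Qed.

Let phi_sum (I : Type) (r : seq I) (Q : pred I) (F : I -> 'I_N -> C) :
  \sum_(i <- r | Q i) phi (F i) = phi (fun s => \sum_(i <- r | Q i) F i s).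
Proof.
rewrite -mulmx_suml -mulmx_sumr -raddf_sum /=.
congr (_ *m diag_mx _ *m _); apply/rowP=> i; rewrite summxE !mxE.
by apply: eq_bigr => ?; rewrite mxE.
Qed.

Let phiA : A = phi (fun r => sp 0 r).
Proof.
by rewrite {1}diagA; congr (_ *m diag_mx _ *m _); apply/rowP=> i; rewrite !mxE.
Qed.

Let sp_eig r : exists2 i : nat, (i <= m)%N & sp 0 r = t i.
Proof.
apply/eig_t/eigenvalueP; exists (row r P).
  rewrite -row_mul [in LHS]diagA !mulmxA mulmxV // mul1mx row_mul.
  by rewrite row_diag_mx -scalemxAl -rowE.
apply/eqP=> P0; have := mulmxV P_unit; move/(congr1 (row r)).
rewrite row_mul P0 mul0mx => /rowP/(_ r)/eqP.
by rewrite !mxE eqxx eq_sym oner_eq0.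
Qed.

Let phi_prod (I : Type) (r : seq I) (Q : pred I) (F : I -> 'I_N -> C) :
  \prod_(i <- r | Q i) phi (F i) = phi (fun s => \prod_(i <- r | Q i) F i s).
Proof.
elim: r => [|i r IHr].
  by rewrite big_nil -phi1; apply: eq_phi => s; rewrite big_nil.
rewrite big_cons IHr; case: ifP => Qi; last first.
  by apply: eq_phi => s; rewrite big_cons Qi.
by rewrite [LHS]phiM; apply: eq_phi => s; rewrite big_cons Qi.
Qed.

Let eigenproj_phi j : (j <= m)%N ->
  eigenproj j = phi (fun r => (sp 0 r == t j)%:R).
Proof.
move=> jm; rewrite /eigenproj.
under eq_bigr => l _.
  have -> : (t j - t l)^-1 *: (A - (t l)%:M) =
            phi (fun r => (t j - t l)^-1 * (sp 0 r - t l)).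
    by rewrite -phiZB -phiA -phiC.
  over.
rewrite phi_prod; apply: eq_phi => r; have [i im ->] := sp_eig r.
have [-> | neq_ij] := eqVneq i j.
  rewrite eqxx big1 // => l lj; rewrite mulVf // subr_eq0.
  by apply: contraNneq lj => /inj_t->; rewrite // inE ltnS // -ltnS.
rewrite (bigD1 (Ordinal (im : i < m.+1)%N)) //= subrr mulr0 mul0r.
apply/esym/eqP; rewrite pnatr_eq0 eqb0.
by apply: contraNN neq_ij => /eqP/inj_t->.
Qed.

Lemma eigenprojM i j : (i <= m)%N -> (j <= m)%N ->
  eigenproj i *m eigenproj j = if i == j then eigenproj i else 0.
Proof.
move=> im jm; rewrite !eigenproj_phi // phiM; case: eqP => [->|/eqP nij].
  by apply: eq_phi => r; case: eqP; rewrite ?mulr1 ?mulr0.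
rewrite (@eq_phi _ (fun=> 0)); last first.
  move=> r; case: eqP => [->|]; rewrite ?mul0r // mul1r; case: eqP => // /inj_t ij.
  by rewrite ij ?eqxx // in nij.
rewrite /phi (_ : \row_r _ = 0) ?raddf0 ?mulmx0 ?mul0mx //.
by apply/rowP=> r; rewrite !mxE.
Qed.

Lemma mul_eigenproj j : (j <= m)%N -> A *m eigenproj j = t j *: eigenproj j.
Proof.
move=> jm; rewrite !eigenproj_phi // {1}phiA phiM.
rewrite /phi scalemxAl scalemxAr; congr (_ *m _ *m _).
apply/matrixP=> r s; rewrite !mxE.
by case: eqP => [->|]; rewrite ?mulr0 ?mul0rn ?mulr0 ?mulrnAr.
Qed.

Lemma sum_eigenproj : \sum_(j < m.+1) eigenproj j = 1.
Proof.
rewrite (eq_bigr (fun j : 'I_m.+1 => phi (fun r => (sp 0 r == t j)%:R)));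
  last first.
  by move=> j _; rewrite eigenproj_phi // -ltnS.
rewrite phi_sum -phi1; apply: eq_phi => r; have [i im ->] := sp_eig r.
rewrite (bigD1 (Ordinal (im : i < m.+1)%N)) //= eqxx big1 ?addr0 // => j nji.
case: eqP => // /inj_t ij; case/eqP: nji; apply: val_inj.
by rewrite /= ij // inE.
Qed.

(** A row eigenvector for [t j] is fixed by every factor of the product. *)
Lemma eigenproj_neq0 j : (j <= m)%N -> eigenproj j != 0.
Proof.
move=> jm.
have /eigenvalueP[u uA u0] : eigenvalue A (t j) by apply/eig_t; exists j.
apply: contraNneq u0 => Ej0.
suff : u *m eigenproj j = u by rewrite Ej0 mulmx0 => <-.
rewrite /eigenproj; elim/big_rec: _ => [|l M lj uM]; first exact: mulmx1.
rewrite -[_ * M]/(_ *m M) mulmxA -scalemxAr mulmxBr uA mul_mx_scalar.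
rewrite -scalerBl scalerA mulVf ?scale1r // subr_eq0.
by apply: contraNneq lj => /inj_t->; rewrite ?inE.
Qed.

End SpectralProjections.

(** * Algebra *)

(** The hypotheses are the first steps of the recurrence
    [c_i f_(i-1) + b_i f_(i+1) = t f_i] with [c_i = k - b_i] and [c_1 = 1]. Both
    differences have the factor [k ^+ 2 - t ^+ 2] because the solution is
    constant for [t = k] and alternating for [t = - k]. *)
Lemma cosine_identity (F : fieldType) (k b2 b3 t f0 f1 f2 f3 f4 : F) :
  k * f1 = t * f0 -> f0 + (k - 1) * f2 = t * f1 ->
  (k - b2) * f1 + b2 * f3 = t * f2 -> (k - b3) * f2 + b3 * f4 = t * f3 ->
  k * (k - 1) * (f0 - f2) = f0 * (k ^+ 2 - t ^+ 2) /\
  k * (k - 1) * (b2 * b3) * (f2 - f4) = f0 * ((k ^+ 2 - t ^+ 2) * (t ^+ 2 - b2)).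
Proof.
move=> E1 E2 E3 E4.
have F2 : k * (k - 1) * f2 = (t ^+ 2 - k) * f0.
  have -> : k * (k - 1) * f2 = k * (f0 + (k - 1) * f2) - k * f0 by ring.
  by rewrite E2 mulrCA E1; ring.
split; first by rewrite mulrBr F2; ring.
have -> : k * (k - 1) * (b2 * b3) * (f2 - f4) =
  b2 * (b3 * (k * (k - 1) * f2)) - k * (k - 1) * b2 * (b3 * f4) by ring.
have -> : b3 * f4 = t * f3 - (k - b3) * f2 by rewrite -E4; ring.
have -> : b2 * (b3 * (k * (k - 1) * f2)) - k * (k - 1) * b2 * (t * f3 - (k - b3) * f2) =
  (b2 * k) * (k * (k - 1) * f2) - k * (k - 1) * t * (b2 * f3) by ring.
have -> : b2 * f3 = t * f2 - (k - b2) * f1 by rewrite -E3; ring.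
have -> : k * (k - 1) * t * (t * f2 - (k - b2) * f1) =
  t ^+ 2 * (k * (k - 1) * f2) - t * (k - 1) * (k - b2) * (k * f1) by ring.
by rewrite F2 E1; ring.
Qed.

Section LinearAlgebra.
Variables (F : fieldType).

(** The maps [p i] act as coordinate projections: spectral projections for
    eigenvectors, dual idempotents for vectors supported at different distances
    from the base vertex. *)
Lemma free_separated (vT : vectType F) (I : eqType) (s : seq I) (u : I -> vT)
    (p : I -> 'End(vT)) :
    uniq s -> (forall i, i \in s -> p i (u i) != 0) ->
    (forall i j, i \in s -> j \in s -> i != j -> p i (u j) = 0) ->
  free [seq u i | i <- s].
Proof.
elim: s => [|i s IHs] /=; first by rewrite nil_free.
case/andP=> i_s uniq_s pu0 puv; rewrite free_cons IHs //; last 2 first.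
- by move=> j js; apply: pu0; rewrite inE js orbT.
- by move=> j l js ls; apply: puv; rewrite inE (js, ls) orbT.
rewrite andbT; apply: contraNN (pu0 i (mem_head _ _)) => ui.
have /subvP/(_ _ ui) : (<<[seq u j | j <- s]>> <= lker (p i))%VS.
  apply/span_subvP=> _ /mapP[j js ->]; rewrite memv_ker; apply/eqP.
  by apply: puv; rewrite ?mem_head ?inE ?js ?orbT //; apply: contraNneq i_s => ->.
by rewrite memv_ker.
Qed.

Lemma dim1_collinear (vT : vectType F) (U : {vspace vT}) a b :
  (\dim U <= 1)%N -> a \in U -> b \in U -> a != 0 -> exists c, b = c *: a.
Proof.
move=> U1 aU bU a0; apply/vlineP.
suff /eqP -> : (<[a]> == U)%VS by [].
by rewrite eqEdim -memvE aU dim_vline a0.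
Qed.

Lemma span_mulmx_stable n (B : 'M[F]_n) (s : seq 'cV[F]_n)
    (U : {vspace 'cV[F]_n}) :
  (forall w, w \in s -> B *m w \in U) ->
  forall w, w \in <<s>>%VS -> B *m w \in U.
Proof.
move=> sU w ws; have -> : B *m w = linfun (mulmx B) w by rewrite lfunE.
have : linfun (mulmx B) w \in (linfun (mulmx B) @: <<s>>)%VS by exact: memv_img.
apply/subvP; rewrite limg_span; apply/span_subvP=> _ /mapP[y ys ->].
by rewrite lfunE sU.
Qed.

End LinearAlgebra.

(** * Distance in a connected graph *)
Section Graph.
Local Open Scope nat_scope.
Variables (X : finType) (e : rel X).
Hypothesis (symE : symmetric e) (irrE : irreflexive e).
Hypothesis connE : connected_graph e.
Local Notation d := (gdist e).

(** A path with at least [#|X|] edges is covered too, since [find] never exceeds the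
    length of the list that it searches. *)
Lemma gdist_min y z p : path e y p -> last y p = z -> d y z <= size p.
Proof.
move=> yp pz; rewrite leqNgt; apply/negP => lt_p.
have lt_pX : size p < #|X|.
  by apply: leq_trans lt_p _; rewrite /gdist -{2}(size_iota 0 #|X|) find_size.
have := before_find 0 lt_p; rewrite nth_iota // add0n.
by move/existsP; case; exists (in_tuple p); rewrite /= yp pz eqxx.
Qed.

Lemma gdist_path y z :
  exists p, [/\ path e y p, last y p = z & size p = d y z].
Proof.
have /connectP[p0 yp0 z_p0] := connE y z.
case/shortenP: yp0 z_p0 => p yp unip _ zp.
have lt_pX : size p < #|X|.
  rewrite -ltnS -[(size p).+1]/(size (y :: p)) -(card_uniqP unip) ltnS.
  exact: max_card.
set P := fun n =>
  [exists p : n.-tuple X, path e y p && (last y p == z)].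
have hasP : has P (iota 0 #|X|).
  apply/hasP; exists (size p); first by rewrite mem_iota.
  by apply/existsP; exists (in_tuple p); rewrite /= yp zp eqxx.
have := nth_find 0 hasP; rewrite -/(gdist e y z) nth_iota; last first.
  by move: hasP; rewrite has_find size_iota.
by case/existsP=> q /andP[yq /eqP qz]; exists q; rewrite size_tuple.
Qed.

Lemma gdist_triangle z y t : d y t <= d y z + d z t.
Proof.
have [p [yp <- <-]] := gdist_path y z.
have [q [zq qt <-]] := gdist_path (last y p) t.
by rewrite -size_cat gdist_min ?cat_path ?yp ?last_cat.
Qed.

Lemma gdist_sym y z : d y z = d z y.
Proof.
suff le_d u t : d t u <= d u t by apply/eqP; rewrite eqn_leq !le_d.
have [p [up <- <-]] := gdist_path u t.
have uq : path e (last u p) (rev (belast u p)).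
  by rewrite rev_path (@eq_path _ _ e) // => a b; rewrite /= symE.
rewrite -(size_belast u p) -size_rev; apply: gdist_min => //.
by case: p {up uq} => //= a p; rewrite rev_cons last_rcons.
Qed.

Lemma gdist_eq0 y z : (d y z == 0) = (y == z).
Proof.
apply/eqP/eqP=> [d0 | ->]; last first.
  by apply/eqP; rewrite -leqn0; exact: (@gdist_min z z [::]).
by have [[|a p] [_ /= pz]] := gdist_path y z; rewrite d0.
Qed.

Lemma gdistxx y : d y y = 0. Proof. by apply/eqP; rewrite gdist_eq0. Qed.

Lemma gdist_eq1 y z : (d y z == 1) = e y z.
Proof.
apply/eqP/idP=> [d1|yz].
  have [[|a [|? ?]] [yp pz]] := gdist_path y z; rewrite d1 //= => _.
  by move: yp pz; rewrite /= andbT => ya <-.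
apply/eqP; rewrite eqn_leq (@gdist_min y z [:: z]) /= ?yz //.
by rewrite lt0n gdist_eq0; apply: contraTneq yz => ->; rewrite irrE.
Qed.

Lemma gdist_edge y y' z : e y y' -> d y z <= (d y' z).+1.
Proof.
rewrite -gdist_eq1 => /eqP d1.
by rewrite (leq_trans (gdist_triangle y' _ _)) // d1.
Qed.

Lemma gdist_pred y z i : d y z = i.+1 -> exists2 y', e y y' & d y' z = i.
Proof.
move=> dyz; have [[|a p] [yp pz]] := gdist_path y z; rewrite dyz //= => -[sz].
case/andP: yp => ya ap; exists a => //; apply/eqP; rewrite eqn_leq.
by rewrite -{1}sz gdist_min //= -ltnS -dyz gdist_edge.
Qed.

Lemma gdist_diameter y z : d y z <= diameter e.
Proof.
apply: leq_trans (leq_bigmax y); exact: (leq_bigmax (F := fun z => d y z)).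
Qed.

(** The distances to the end of a longest geodesic take all the values down to
    0. *)
Lemma gdist_onto (x : X) i : i <= diameter e -> exists y z, d y z = i.
Proof.
have X0 : 0 < #|X| by apply/card_gt0P; exists x.
have [y [z ->]] : exists y z, diameter e = d y z.
  rewrite /diameter.
  have [y ->] := @bigop.eq_bigmax X (fun y => \max_z d y z) X0.
  by have [z ->] := @bigop.eq_bigmax X (d y) X0; exists y, z.
move/subnKC; move: (_ - i) => j; elim: j y => [|j IHj] y.
  by rewrite addn0 => ->; exists y, z.
by rewrite addnS => /esym/gdist_pred[y' _ /esym/IHj].
Qed.

(** * Parity and intersection numbers *)
Hypothesis (bipE : bipartite e) (drE : distance_regular e).
Local Notation D := (diameter e).

Lemma bipartite_colouring :
  exists side : pred X, forall y z, e y z -> side y = ~~ side z.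
Proof.
case: bipE => S [SS CC]; exists (mem S) => y z yz.
case: (boolP (y \in S)) => [yS|yC]; case: (boolP (z \in S)) => [zS|zC] /=;
  rewrite ?yS ?zS ?(negPf yC) ?(negPf zC) //.
- by have := SS y z yS zS; rewrite yz.
- by have := CC y z yC zC; rewrite yz.
Qed.

Lemma bipartite_parity (side : pred X) :
  (forall y z, e y z -> side y = ~~ side z) ->
  forall y z, odd (d y z) = side y (+) side z.
Proof.
move=> sideE y z; move dE: (d y z) => i; elim: i y dE => [|i IHi] y dE.
  by move/eqP: dE; rewrite gdist_eq0 // => /eqP ->; rewrite addbb.
have [y' yy' d'] := gdist_pred dE.
by rewrite oddS (IHi _ d') (sideE _ _ yy') addNb.
Qed.

Lemma odd_gdist x y z : odd (d y z) = odd (d x y) (+) odd (d x z).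
Proof.
have [side sideE] := bipartite_colouring.
rewrite !(bipartite_parity sideE).
by case: (side x); case: (side y); case: (side z).
Qed.

Lemma gdist_step y y' z : e y y' ->
  (d y' z == (d y z).+1) || (d y z == (d y' z).+1).
Proof.
move=> yy'; have le1 := gdist_edge z yy'.
have le2 : d y' z <= (d y z).+1 by rewrite gdist_edge // symE.
have odd1 : d y z != d y' z.
  apply/eqP=> dE; have := odd_gdist z y y'.
  have /eqP -> : d y y' == 1 by rewrite gdist_eq1.
  by rewrite ![d z _](gdist_sym) dE addbb.
case: (ltngtP (d y z) (d y' z)) odd1 => // lt _.
  by rewrite (eqn_leq (d y' z)) le2 lt.
by rewrite (eqn_leq (d y z)) le1 lt orbT.
Qed.

Definition cnum (i : nat) : nat := pnum e i 1 i.-1.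

Lemma pcountE h i j y z : d y z = h -> h <= D -> i <= D -> j <= D ->
  pcount e i j y z = pnum e h i j.
Proof.
move=> dE hD iD jD; rewrite /pnum; case: pickP => [[a b] /= /eqP ab | /(_ (y, z))].
  exact: (drE hD iD jD).
by rewrite /= dE eqxx.
Qed.

Lemma card_farther i y z : i < D -> d y z = i ->
  #|[set w | e y w && (d w z == i.+1)]| = bnum e i.
Proof.
move=> iD dE; rewrite /bnum -(@pcountE _ _ _ y z) //; last 2 first.
- exact: ltnW.
- exact: leq_ltn_trans iD.
by apply: eq_card => w; rewrite !inE gdist_eq1.
Qed.

Lemma card_closer i y z : i < D -> d y z = i.+1 ->
  #|[set w | e y w && (d w z == i)]| = cnum i.+1.
Proof.
move=> iD dE; rewrite /cnum -(@pcountE _ _ _ y z) //; last 2 first.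
- exact: leq_ltn_trans iD.
- exact: ltnW.
by apply: eq_card => w; rewrite !inE gdist_eq1.
Qed.

Lemma card_neighbours y : 0 < D -> #|[set w | e y w]| = valency e.
Proof.
move=> D0; rewrite /valency -(@card_farther 0 y y) ?gdistxx //.
by apply: eq_card => w; rewrite !inE gdist_eq1 // symE andbb.
Qed.

Lemma cnum1 (x : X) : 0 < D -> cnum 1 = 1.
Proof.
move=> D0; have [y [z dE]] := gdist_onto x D0.
rewrite -(card_closer D0 dE) -(cards1 z); apply: eq_card => w; rewrite !inE.
rewrite gdist_eq0 // andbC; case: eqP => //= ->.
by rewrite -gdist_eq1 // dE.
Qed.

Lemma bnumDcnum (x : X) i : 0 < i < D -> bnum e i + cnum i = valency e.
Proof.
case/andP; case: i => // i _ iD; have [y [z dE]] := gdist_onto x (ltnW iD).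
rewrite -(card_farther iD dE) -(card_closer (ltnW iD) dE).
rewrite -(card_neighbours y (leq_ltn_trans _ iD)) // -cardsUI.
rewrite [X in _ + #|pred_of_set X|](_ : _ = set0) ?cards0 ?addn0; last first.
  by apply/setP=> w; rewrite !inE; case: (d w z =P i.+2) => [->|_];
    rewrite ?andbF // gtn_eqF ?andbF.
apply: eq_card => w; rewrite !inE -andb_orr; case yw: (e y w) => //=.
by have := gdist_step z yw; rewrite dE eqSS [i == _]eq_sym.
Qed.

Lemma cnum_gt0 (x : X) i : 0 < i <= D -> 0 < cnum i.
Proof.
case/andP; case: i => // i _ iD; have [y [z dE]] := gdist_onto x iD.
have [w yw dw] := gdist_pred dE.
rewrite -(card_closer iD dE) card_gt0; apply/set0Pn; exists w.
by rewrite inE yw dw eqxx.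
Qed.

Lemma sum_pcount (V : nmodType) (f : nat -> V) y z :
  (\sum_(w | e y w) f (d w z) = \sum_(j < D.+1) f j *+ pcount e 1 j y z)%R.
Proof.
rewrite (partition_big (fun w => inord (d w z) : 'I_D.+1) predT) //=.
apply: eq_bigr => j _; rewrite /pcount -sum1dep_card -GRing.sumrMnr.
rewrite [RHS](eq_bigl (fun w => e y w && (inord (d w z) == j))); last first.
  move=> w; rewrite gdist_eq1 //; congr (_ && _).
  by rewrite -(inj_eq val_inj) /= inordK // ltnS gdist_diameter.
apply: eq_bigr => w /andP[_ /eqP <-].
by rewrite inordK ?mulr1n // ltnS gdist_diameter.
Qed.

(** Distance-regularity in the form that makes matrices with entries depending
    only on the distance stable under multiplication by [A]. *)
Lemma sum_neighbours_dist (V : nmodType) (f : nat -> V) y z y' z' :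
  0 < D -> d y z = d y' z' ->
  (\sum_(w | e y w) f (d w z) = \sum_(w | e y' w) f (d w z'))%R.
Proof.
move=> D0 dE; rewrite !sum_pcount; apply: eq_bigr => j _.
by rewrite (@drE (d y z) 1 j _ _ _ y z y' z') ?gdist_diameter // -ltnS.
Qed.

Lemma sum_neighbours (V : nmodType) (f : nat -> V) i y z :
  0 < i < D -> d y z = i ->
  (\sum_(w | e y w) f (d w z) = f i.-1 *+ cnum i + f i.+1 *+ bnum e i)%R.
Proof.
case/andP; case: i => // i _ iD dE.
rewrite (bigID (fun w => d w z == i)) /=; congr (_ + _)%R.
  rewrite -(card_closer (ltnW iD) dE) -sumr_const.
  rewrite [RHS](eq_bigl (fun w => e y w && (d w z == i))).
    by apply: eq_bigr => w /andP[_ /eqP ->].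
  by move=> w; rewrite inE.
rewrite -(card_farther iD dE) -sumr_const.
rewrite [RHS](eq_bigl (fun w => e y w && (d w z != i))).
  apply: eq_bigr => w /andP[yw]; have := gdist_step z yw.
  by rewrite dE eqSS [i == _]eq_sym => /orP[/eqP -> //| ->].
move=> w; rewrite inE; case yw: (e y w) => //=; have := gdist_step z yw.
rewrite dE eqSS [i == _]eq_sym => /orP[/eqP -> //|/eqP ->]; rewrite eqxx //.
  by rewrite gtn_eqF.
by rewrite ltn_eqF.
Qed.

Lemma sum_neighbours0 (V : nmodType) (f : nat -> V) y : 0 < D ->
  (\sum_(w | e y w) f (d w y) = f 1 *+ valency e)%R.
Proof.
move=> D0; rewrite -(card_neighbours y D0) -sumr_const.
rewrite [RHS](eq_bigl (e y)); last by move=> w; rewrite inE.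
by apply: eq_bigr => w; rewrite symE -gdist_eq1 // => /eqP ->.
Qed.

(** * The spectral projections as functions of the distance *)
Section Radial.
Local Open Scope ring_scope.
Variable R : realType.
Hypothesis D_gt0 : (0 < D)%N.
Local Notation C := R[i].
Local Notation A := (adj_mx C e).
Local Notation k := (valency e).

(** The elements of the Bose-Mesner algebra with real entries; they are Hermitian
    by construction. *)
Definition radial_mx (f : nat -> R) : 'M[C]_#|X| :=
  \matrix_(r, s) (f (d (enum_val r) (enum_val s)))%:C%C.

Lemma sum_enum_val (V : nmodType) (F : X -> V) :
  \sum_(s < #|X|) F (enum_val s) = \sum_z F z.
Proof.
rewrite [RHS](reindex (@enum_val X predT)) //; exact/onW_bij/enum_val_bij.
Qed.

Lemma mul_adj_mx p (M : 'M[C]_(#|X|, p)) r s :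
  (A *m M) r s = \sum_(w | e (enum_val r) w) M (enum_rank w) s.
Proof.
rewrite mxE [RHS]big_mkcond /= -sum_enum_val; apply: eq_bigr => q _.
by rewrite mxE gdist_eq1 // enum_valK; case: ifP; rewrite ?mul1r ?mul0r.
Qed.

Lemma radial_mx1 : 1%:M = radial_mx (fun i => (i == 0)%:R).
Proof.
apply/matrixP=> r s; rewrite !mxE gdist_eq0 // (inj_eq enum_val_inj).
by case: eqP; rewrite ?rmorph1 ?rmorph0.
Qed.

(** The new function can be evaluated at any pair of vertices at the given
    distance. *)
Lemma mul_adj_radial_mx f : exists g, A *m radial_mx f = radial_mx g.
Proof.
pose g i := if [pick yz : X * X | d yz.1 yz.2 == i] is Some yz
  then \sum_(w | e yz.1 w) f (d w yz.2) else 0.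
exists g; apply/matrixP=> r s; rewrite mul_adj_mx mxE /g.
case: pickP => [[y z] /= /eqP yz|/(_ (enum_val r, enum_val s))]; last first.
  by rewrite eqxx.
rewrite (sum_neighbours_dist f D_gt0 yz) rmorph_sum /=.
by apply: eq_bigr => w _; rewrite mxE enum_rankK.
Qed.

Lemma adj_mx_normal : A \is normalmx.
Proof.
apply: symmetric_normalmx.
  apply/is_hermitianmxP; rewrite expr0 scale1r.
  by apply/matrixP=> r s; rewrite !mxE gdist_sym.
by apply/mxOverP=> r s; rewrite mxE realn.
Qed.

Variable theta : nat -> R.
Hypothesis thetaE : ordered_eigenvalues A D theta.

Let inj_theta : {in gtn D.+1 &, injective theta}.
Proof.
move=> i j; rewrite !inE !ltnS => iD jD tij.
have [ltij|ltji|//] := ltngtP i j.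
- by have := thetaE.1 _ _ ltij jD; rewrite tij ltxx.
- by have := thetaE.1 _ _ ltji iD; rewrite tij ltxx.
Qed.

Let injC : {in gtn D.+1 &, injective (fun j => (theta j)%:C%C)}.
Proof. by move=> i j iD jD /complexI; exact: inj_theta. Qed.

Definition Eproj (j : nat) := eigenproj A D (fun j => (theta j)%:C%C) j.

Lemma Eproj_radial : exists f : 'I_D.+1 -> nat -> R,
  forall j : 'I_D.+1, Eproj j = radial_mx (f j).
Proof.
have H (j : 'I_D.+1) : exists h, Eproj j = radial_mx h; last first.
  exact: (fin_all_exists H).
apply: (@eigenproj_ind _ _ _ _ _ (fun M => exists h, M = radial_mx h)).
  by exists (fun i => (i == 0)%:R); exact: radial_mx1.
move=> i l M [f ->]; have [g ->] := mul_adj_radial_mx f.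
exists (fun m => (theta i - theta l)^-1 * (g m - theta l * f m)).
by apply/matrixP=> r s; rewrite !mxE !(rmorphM, rmorphB, fmorphV).
Qed.

(* [f j i] is the entry of the projection [Eproj j] at distance [i], that is, up
   to a factor, the cosine sequence of [theta j]. *)
Variable f : 'I_D.+1 -> nat -> R.
Hypothesis fE : forall j : 'I_D.+1, Eproj j = radial_mx (f j).

Lemma mulmx_radialE g h r s :
  (radial_mx g *m radial_mx h) r s =
  (\sum_w g (d (enum_val r) w) * h (d w (enum_val s)))%:C%C.
Proof.
rewrite mxE -sum_enum_val rmorph_sum; apply: eq_bigr => q _.
by rewrite !mxE rmorphM.
Qed.

Lemma proj_idempotent j y z : \sum_w f j (d y w) * f j (d w z) = f j (d y z).
Proof.
have := eigenprojM adj_mx_normal injC thetaE.2 (leq_ord j) (leq_ord j).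
rewrite eqxx -/(Eproj j) fE => /matrixP/(_ (enum_rank y) (enum_rank z)).
by rewrite mulmx_radialE !mxE !enum_rankK => /complexI.
Qed.

Lemma proj_eig j y z : \sum_(w | e y w) f j (d w z) = theta j * f j (d y z).
Proof.
have := mul_eigenproj adj_mx_normal injC thetaE.2 (leq_ord j).
rewrite -/(Eproj j) fE => /matrixP/(_ (enum_rank y) (enum_rank z)).
rewrite mul_adj_mx !mxE !enum_rankK -rmorphM; move=> E; apply: complexI.
by rewrite -E rmorph_sum; apply: eq_bigr => w _; rewrite mxE !enum_rankK.
Qed.

Lemma proj_sum i : X -> (i <= D)%N -> \sum_j f j i = (i == 0)%:R.
Proof.
move=> x iD; have := sum_eigenproj adj_mx_normal injC thetaE.2.
rewrite (eq_bigr (fun j => radial_mx (f j))); last by move=> j _; exact: fE.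
have [y [z <-]] := gdist_onto x iD.
move/matrixP/(_ (enum_rank y) (enum_rank z)).
rewrite -[1]/1%:M radial_mx1 summxE !mxE !enum_rankK => E.
apply: complexI; rewrite -E rmorph_sum.
by apply: eq_bigr => j _; rewrite mxE !enum_rankK.
Qed.

Lemma proj_rec0 (x : X) j : k%:R * f j 1 = theta j * f j 0%N.
Proof.
have := proj_eig j x x; rewrite gdistxx // sum_neighbours0 // => <-.
by rewrite mulr_natl.
Qed.

Lemma proj_rec (x : X) j i : (0 < i < D)%N ->
  (cnum i)%:R * f j i.-1 + (bnum e i)%:R * f j i.+1 = theta j * f j i.
Proof.
move=> iD; have /andP[_ /ltnW iD'] := iD; have [y [z dE]] := gdist_onto x iD'.
by have := proj_eig j y z; rewrite (sum_neighbours _ iD dE) dE !mulr_natl.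
Qed.

Lemma proj_norm j y : \sum_w f j (d y w) ^+ 2 = f j 0%N.
Proof.
transitivity (f j (d y y)); last by rewrite gdistxx.
by rewrite -proj_idempotent; apply: eq_bigr => w _; rewrite expr2 (gdist_sym w).
Qed.

(** A diagonal entry of a real symmetric idempotent is the squared norm of the
    corresponding row; if it vanishes, all the rows do. *)
Lemma proj0_gt0 (x : X) j : 0 < f j 0%N.
Proof.
rewrite lt_def -(proj_norm j x) sumr_ge0 => [|w _]; last exact: sqr_ge0.
rewrite andbT proj_norm; apply/eqP => f0.
have := eigenproj_neq0 injC thetaE.2 (leq_ord j).
rewrite -/(Eproj j) fE => /negP[]; apply/eqP/matrixP=> r s; rewrite !mxE.
set y := enum_val r; set z := enum_val s.
have /psumr_eq0P : \sum_w f j (d y w) ^+ 2 = 0 by rewrite proj_norm.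
by move/(_ (fun w _ => sqr_ge0 _) z isT)/eqP; rewrite sqrf_eq0 => /eqP->.
Qed.

(** Comparing the rows of the projection at two adjacent vertices gives
    [`|f j 1| <= f j 0], and [k * f j 1 = theta j * f j 0]. *)
Lemma theta_le_valency (x : X) (j : 'I_D.+1) : `|theta j| <= k%:R.
Proof.
have [y [z yz]] := gdist_onto x D_gt0.
have f0 := proj0_gt0 x j.
have bound (s : R) : s ^+ 2 = 1 -> 0 <= f j 0%N + s * f j 1.
  move=> s2; have : 0 <= \sum_w (f j (d y w) + s * f j (d w z)) ^+ 2.
    by apply: sumr_ge0 => w _; exact: sqr_ge0.
  rewrite (eq_bigr (fun w =>
     f j (d y w) * f j (d w y) + f j (d z w) * f j (d w z) +
     s * (f j (d y w) * f j (d w z)) *+ 2)); last first.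
    move=> w _; rewrite sqrrD exprMn s2 mul1r !expr2.
    by rewrite (gdist_sym w y) (gdist_sym z w) mulrCA addrAC.
  rewrite !big_split /= -mulr_sumr !proj_idempotent !gdistxx // yz -mulr2n -mulrnDl.
  by rewrite pmulrn_lge0.
have boundk s : s ^+ 2 = 1 -> 0 <= k%:R + s * theta j.
  move=> s2; rewrite -(pmulr_lge0 _ f0) mulrDl -mulrA -(proj_rec0 x) mulrCA.
  by rewrite -mulrDr mulr_ge0 ?ler0n ?bound.
have := boundk 1 (expr1n _ _).
have := boundk (-1); rewrite sqrrN expr1n => /(_ erefl).
rewrite mulN1r mul1r subr_ge0 -lerBlDl sub0r ler_norml lerNl => -> /=.
by rewrite lerNl => ->.
Qed.

(** * The eigenvalues of a bipartite distance-regular graph *)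
Lemma eigenvalue_valency (x : X) : eigenvalue A (k%:R : C).
Proof.
apply/eigenvalueP; exists (const_mx 1); last first.
  by apply/eqP=> /rowP/(_ (enum_rank x))/eqP; rewrite !mxE oner_eq0.
apply/rowP=> s; rewrite !mxE mulr1 -(card_neighbours (enum_val s) D_gt0).
rewrite -sum1_card natr_sum [RHS]big_mkcond /= -sum_enum_val; apply: eq_bigr => r _.
by rewrite !mxE mul1r inE gdist_eq1 // symE; case: ifP.
Qed.

(** Change the sign of an eigenvector on one of the two colour classes. *)
Lemma eigenvalueN (a : C) : eigenvalue A a -> eigenvalue A (- a).
Proof.
have [side sideE] := bipartite_colouring.
pose sg (r : 'I_#|X|) : C := (-1) ^+ side (enum_val r : X).
case/eigenvalueP=> u uA u0; apply/eigenvalueP; exists (\row_r (sg r * u 0 r)).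
  apply/rowP=> s; rewrite !mxE.
  rewrite (_ : _ * (_ * _) = - sg s * (a * u 0 s)); last by ring.
  have /rowP/(_ s) := uA; rewrite !mxE mulNr => <-.
  rewrite mulr_sumr -sumrN; apply: eq_bigr => r _; rewrite !mxE gdist_eq1 //.
  case rs: (e _ _); last by rewrite !(mulr0, oppr0).
  by rewrite /sg (sideE _ _ rs) signrN; ring.
apply: contraNneq u0 => /rowP v0; apply/eqP/rowP=> r; have := v0 r.
by rewrite !mxE; move/eqP; rewrite mulf_eq0 signr_eq0 => /eqP.
Qed.

(** The spectrum is symmetric about 0, and a finite set of reals has only one
    decreasing enumeration. *)
Lemma thetaN i : (i <= D)%N -> theta (D - i) = - theta i.
Proof.
move=> iD; pose s := mkseq theta D.+1.
pose s' := mkseq (fun i => - theta (D - i)%N) D.+1.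
suff /(congr1 (nth 0 ^~ i)) : s = s'.
  by rewrite !nth_mkseq // => ->; rewrite opprK.
have sort_s : sorted >%R s.
  apply/(sortedP 0) => j; rewrite size_mkseq => jD.
  rewrite !nth_mkseq ?(ltnW jD) //.
  exact: thetaE.1.
have sort_s' : sorted >%R s'.
  apply/(sortedP 0) => j; rewrite size_mkseq => jD.
  rewrite !nth_mkseq ?(ltnW jD) //.
  suff : theta (D - j)%N < theta (D - j.+1)%N by rewrite -ltrN2.
  by apply: thetaE.1; [exact: ltn_sub2l | exact: leq_subr].
apply: (irr_sorted_eq (leT := >%R)) sort_s sort_s' _ => //.
- by move=> a b c /= ba cb; exact: lt_trans cb ba.
- by move=> a; rewrite /= ltxx.
have memP a : reflect (eigenvalue A a%:C%C) (a \in s).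
  apply: (iffP mapP) => [[j + ->]|/thetaE.2[j jD /complexI ->]].
    by rewrite mem_iota ltnS => /andP[_ jD]; apply/thetaE.2; exists j.
  by exists j; rewrite // mem_iota.
have mem'P a : reflect (eigenvalue A (- a)%:C%C) (a \in s').
  apply: (iffP mapP) => [[j + ->]|/thetaE.2[j jD /complexI aE]].
    by rewrite opprK => _; apply/thetaE.2; exists (D - j)%N; rewrite ?leq_subr.
  by exists (D - j)%N; rewrite ?mem_iota ?ltnS ?leq_subr // subKn // -aE opprK.
move=> a; apply/memP/mem'P => /eigenvalueN; rewrite -rmorphN ?opprK //.
Qed.

Lemma theta0 (x : X) : theta 0 = k%:R.
Proof.
have := eigenvalue_valency x; rewrite -(rmorph_nat (real_complex R)).
case/thetaE.2 => i iD /complexI ki; apply/eqP; rewrite eq_le.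
have := theta_le_valency x ord0; rewrite ler_norml => /andP[_ ->] /=.
rewrite ki; case: i iD {ki} => // i iD; exact/ltW/thetaE.1.
Qed.

Lemma theta_sq_eq i j : (i <= D)%N -> (j <= D)%N ->
  (theta i ^+ 2 == theta j ^+ 2) = (i == j) || (i == D - j)%N.
Proof.
move=> iD jD; rewrite eqf_sqr -thetaN //.
by rewrite !(inj_in_eq inj_theta) ?inE ?ltnS ?leq_subr.
Qed.

Hypothesis D_ge4 : (4 <= D)%N.
Hypothesis k_ge3 : (3 <= k)%N.
Local Notation b i := ((bnum e i)%:R : R).

Lemma proj_cosine (x : X) j :
  k%:R * (k%:R - 1) * (f j 0%N - f j 2) = f j 0%N * (k%:R ^+ 2 - theta j ^+ 2) /\
  k%:R * (k%:R - 1) * (b 2 * b 3) * (f j 2 - f j 4) =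
    f j 0%N * ((k%:R ^+ 2 - theta j ^+ 2) * (theta j ^+ 2 - b 2)).
Proof.
have bc i : (0 < i < D)%N -> (cnum i)%:R = k%:R - b i :> R.
  by move=> iD; rewrite -(bnumDcnum x iD) natrD addrC addKr.
have D1 : (0 < 1 < D)%N by rewrite (leq_trans _ D_ge4).
have D2 : (0 < 2 < D)%N by rewrite (leq_trans _ D_ge4).
have D3 : (0 < 3 < D)%N by rewrite (leq_trans _ D_ge4).
have b1 : b 1 = k%:R - 1 by rewrite -(bnumDcnum x D1) (cnum1 x) // natrD addrK.
apply: cosine_identity (proj_rec0 x j) _ _ _.
- by rewrite -(proj_rec x j D1) (cnum1 x) // mul1r b1.
- by rewrite -(proj_rec x j D2) bc.
- by rewrite -(proj_rec x j D3) bc.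
Qed.

Let k1_gt0 : 0 < k%:R * (k%:R - 1) :> R.
Proof. by rewrite mulr_gt0 ?subr_gt0 ?ltr1n ?ltr0n // (leq_trans _ k_ge3). Qed.

(** The projections add up to the identity, so the sums over [j] of [f j 2] and
    of [f j 4] both vanish. *)
Lemma sum_proj_theta (x : X) :
  \sum_j f j 0%N * ((k%:R ^+ 2 - theta j ^+ 2) * (theta j ^+ 2 - b 2)) = 0.
Proof.
rewrite (eq_bigr _ (fun j _ => esym (proj_cosine x j).2)) -mulr_sumr sumrB.
by rewrite !(proj_sum x) ?subrr ?mulr0 // (leq_trans _ D_ge4).
Qed.

Lemma valency_sq_ge (x : X) (j : 'I_D.+1) : 0 <= k%:R ^+ 2 - theta j ^+ 2.
Proof.
rewrite subr_ge0 -(real_normK (num_real (theta j))).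
by rewrite lerXn2r ?nnegrE ?theta_le_valency.
Qed.

(** By [sum_proj_theta], [b 2] is the mean of the squares of the eigenvalues other
    than [k] and [- k], with positive weights. If it equalled an extreme one of these
    squares, all of them would coincide; but a square is taken only twice,
    and [theta 1], [theta 2] and [theta 3] are distinct. *)
Lemma theta_sq_neq_b2 (x : X) n : (0 < n < D)%N ->
  (forall j, (0 < j < D)%N -> theta j ^+ 2 <= theta n ^+ 2) \/
  (forall j, (0 < j < D)%N -> theta n ^+ 2 <= theta j ^+ 2) ->
  theta n ^+ 2 != b 2.
Proof.
move=> /andP[n0 nD] ext; apply/eqP=> tn.
pose c (j : 'I_D.+1) :=
  f j 0%N * ((k%:R ^+ 2 - theta j ^+ 2) * (theta j ^+ 2 - b 2)).
have edge (j : 'I_D.+1) : ~~ (0 < j < D)%N -> c j = 0.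
  rewrite negb_and -leqNgt leqn0 -leqNgt => jE.
  suff /eqP tj : theta j ^+ 2 == k%:R ^+ 2 by rewrite /c tj subrr mul0r mulr0.
  rewrite -(theta0 x) theta_sq_eq ?leq_ord // subn0.
  by rewrite (eqn_leq j D) leq_ord.
have c0 j : c j = 0.
  case: ext => ext.
  - have c_le i : 0 <= - c i.
      case: (boolP (0 < i < D)%N) => [iD | /edge->]; last by rewrite oppr0.
      rewrite /c -mulrN -mulrN opprB.
      apply: mulr_ge0; first exact/ltW/proj0_gt0.
      by apply: mulr_ge0; [exact: valency_sq_ge | rewrite subr_ge0 -tn ext].
    have /psumr_eq0P : \sum_i - c i = 0 by rewrite sumrN sum_proj_theta ?oppr0.
    by move/(_ (fun i _ => c_le i) j isT)/eqP; rewrite oppr_eq0 => /eqP.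
  - have c_ge i : 0 <= c i.
      case: (boolP (0 < i < D)%N) => [iD | /edge->]; last by [].
      apply: mulr_ge0; first exact/ltW/proj0_gt0.
      by apply: mulr_ge0; [exact: valency_sq_ge | rewrite subr_ge0 -tn ext].
    have /psumr_eq0P : \sum_i c i = 0 by rewrite sum_proj_theta.
    exact: (fun H => H (fun i _ => c_ge i) j isT).
have sq j : (0 < j < D)%N -> (j == n) || (j == D - n)%N.
  case/andP=> j0 jD; rewrite -theta_sq_eq ?(ltnW jD) ?(ltnW nD) // tn.
  have /eqP := c0 (Ordinal (ltnW jD : (j < D.+1)%N)).
  rewrite /c !mulf_eq0 (gt_eqF (proj0_gt0 x _)) /= !subr_eq0 => /orP[]//.
  rewrite eq_sym -(theta0 x) theta_sq_eq ?(ltnW jD) // subn0.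
  by rewrite gtn_eqF // ltn_eqF.
have := sq 1%N; have := sq 2%N; have := sq 3%N.
by move: D_ge4; clear; lia.
Qed.

(** Beside making [theta n ^+ 2] extreme, these choices ensure [n <> D - n], so
    that [theta n] and [- theta n] are two eigenvalues; for even [D],
    [theta D./2] is 0. *)
Definition admissible n := if odd D then n = 1%N \/ n = D./2 else n = 1%N.

Lemma admissible_bounds n : admissible n -> (0 < n < D)%N /\ n <> (D - n)%N.
Proof. by rewrite /admissible; move: D_ge4; case: ifP; lia. Qed.

Lemma theta_le i j : (i <= j)%N -> (j <= D)%N -> theta j <= theta i.
Proof.
rewrite leq_eqVlt => /orP[/eqP -> //|ij] jD; exact/ltW/thetaE.1.
Qed.

(** By symmetry of the spectrum, [theta 1] is the largest in absolute value below
    [k], and for odd [D] the eigenvalue following [theta D./2] is its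
    opposite. *)
Lemma admissible_extremal n : admissible n ->
  (forall j, (0 < j < D)%N -> theta j ^+ 2 <= theta n ^+ 2) \/
  (forall j, (0 < j < D)%N -> theta n ^+ 2 <= theta j ^+ 2).
Proof.
move=> adm.
have [-> | [oddD nE]] : n = 1%N \/ odd D /\ n = D./2.
- move: adm; rewrite /admissible.
  by case: ifP => [oddD []|_]; by [left | right].
- left=> j /andP[j0 jD]; rewrite -[leLHS]real_normK ?num_real //.
  have le1 : `|theta j| <= theta 1.
    rewrite ler_norml -thetaN ?(leq_trans _ D_ge4) //.
    by rewrite !theta_le // ?leq_subr //; move: jD; clear; lia.
  by rewrite lerXn2r ?nnegrE // (le_trans _ le1).
right=> j /andP[j0 jD].
have nD : (n <= D)%N by rewrite nE; lia.
have DnE : (D - n = n.+1)%N by rewrite nE; lia.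
have tn0 : 0 < theta n.
  have := thetaE.1 n n.+1 (ltnSn n).
  rewrite -DnE leq_subr thetaN // => /(_ isT) ?; lra.
suff le1 : theta n <= `|theta j|.
  by rewrite -[leRHS]real_normK ?num_real // lerXn2r ?nnegrE // (ltW tn0).
have [jn|nj] := leqP j n; first by rewrite (le_trans _ (ler_norm _)) ?theta_le.
rewrite -normrN -thetaN ?(ltnW jD) // (le_trans _ (ler_norm _)) // theta_le //.
by rewrite -ltnS -DnE in nj *; lia.
Qed.

Definition local_theta n : R := - 1 - b 2 * b 3 / (theta n ^+ 2 - b 2).

(** The factor by which [E_2^* E_j] multiplies [v]. The contribution of distance 4
    has been eliminated by means of the vanishing sum of the entries of [v]. *)
Definition local_ratio n j : R :=
  (f j 0%N - f j 4) + (f j 2 - f j 4) * local_theta n.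

(** Multiplied by [k (k - 1)], the ratio is [f j 0] times
    [(k^2 - theta_j^2) (theta_n^2 - theta_j^2) / (theta_n^2 - b_2)]. *)
Lemma local_ratio_eq0 (x : X) n j : admissible n ->
  (local_ratio n j == 0) = (val j \in [:: 0; D; n; D - n]%N).
Proof.
move=> adm; have [n0D _] := admissible_bounds adm; have /andP[n0 nD] := n0D.
have nz : theta n ^+ 2 - b 2 != 0.
  by rewrite subr_eq0 (theta_sq_neq_b2 x) //; exact: admissible_extremal.
have [E1 E2] := proj_cosine x j.
have ratioE : k%:R * (k%:R - 1) * local_ratio n j =
    f j 0%N * (k%:R ^+ 2 - theta j ^+ 2) * (theta n ^+ 2 - theta j ^+ 2)
      / (theta n ^+ 2 - b 2).
  transitivity (k%:R * (k%:R - 1) * (f j 0%N - f j 2) -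
     k%:R * (k%:R - 1) * (b 2 * b 3) * (f j 2 - f j 4) / (theta n ^+ 2 - b 2)).
    by rewrite /local_ratio /local_theta; ring.
  by rewrite E1 E2; field.
rewrite -(inj_eq (mulfI (lt0r_neq0 k1_gt0))) mulr0 ratioE.
rewrite !mulf_eq0 (gt_eqF (proj0_gt0 x _)) invr_eq0 (negPf nz) orbF /=.
rewrite !subr_eq0 -(theta0 x) ![_ == theta j ^+ 2]eq_sym.
by rewrite !theta_sq_eq ?leq_ord ?(ltnW nD) // subn0 !inE !orbA.
Qed.

(** * Thin irreducible modules with endpoint 2 *)
Section Module.
Variables (x : X) (W : {vspace 'cV[C]_#|X|}).
Hypotheses (W_irr : irreducible_Tmodule e x W) (W_thin : thin e x W).
Hypothesis (W_end : has_endpoint e x W 2).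
Local Notation Es i := (Estar C e x i).

Lemma mul_Estar i p (M : 'M[C]_(#|X|, p)) r s :
  (Es i *m M) r s = if d x (enum_val r) == i then M r s else 0.
Proof.
rewrite mxE (bigD1 r) //= big1 ?addr0; last first.
  by move=> q qr; rewrite mxE eq_sym (negPf qr) mul0r.
by rewrite mxE eqxx; case: eqP; rewrite ?mul1r ?mul0r.
Qed.

Lemma EstarM i j p (M : 'M[C]_(#|X|, p)) :
  Es i *m (Es j *m M) = if i == j then Es i *m M else 0.
Proof.
apply/matrixP=> r s; have [<-|ij] := eqVneq i j; rewrite !mul_Estar.
  by case: eqP.
by rewrite mxE; case: eqP => // ->; rewrite (negPf ij).
Qed.

Lemma Estar_gt_diameter i p (M : 'M[C]_(#|X|, p)) : (D < i)%N -> Es i *m M = 0.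
Proof.
move=> Di; apply/matrixP=> r s; rewrite mul_Estar mxE ltn_eqF //.
exact: leq_ltn_trans (gdist_diameter _ _) Di.
Qed.

Lemma mem_adj u : u \in W -> A *m u \in W.
Proof. by case: W_irr => WT _ _; apply: WT; constructor. Qed.

Lemma mem_Estar i u : u \in W -> Es i *m u \in W.
Proof.
case: W_irr => WT _ _ uW; have [iD|Di] := leqP i D; last first.
  by rewrite Estar_gt_diameter ?mem0v.
by apply: WT => //; constructor.
Qed.

Lemma mem_EstarW i u : u \in W -> Es i *m u \in EstarW e x i W.
Proof.
move=> uW.
by rewrite (_ : Es i *m u = linfun (mulmx (Es i)) u) ?memv_img ?lfunE.
Qed.

Lemma EstarW_P i u : u \in EstarW e x i W -> u \in W /\ Es i *m u = u.
Proof.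
case/memv_imgP=> w wW ->; rewrite lfunE /= mem_Estar //.
by rewrite EstarM eqxx.
Qed.

Lemma Estar_lt2 i u : (i < 2)%N -> u \in W -> Es i *m u = 0.
Proof.
move=> i2 /(mem_EstarW i); case: W_end => _ _ /(_ i i2) ->.
by rewrite memv0 => /eqP.
Qed.

Lemma Estar_collinear i u u' : u \in W -> u' \in W -> Es i *m u != 0 ->
  exists c, Es i *m u' = c *: (Es i *m u).
Proof.
move=> uW u'W u0; have iD : (i <= D)%N.
  by rewrite leqNgt; apply: contraNN u0 => Di; rewrite Estar_gt_diameter.
exact: dim1_collinear (W_thin iD) (mem_EstarW i uW) (mem_EstarW i u'W) u0.
Qed.

(** Adjacent vertices are never equidistant from [x]. *)
Lemma adj_Estar i (u : 'cV[C]_#|X|) : Es i.+1 *m u = u ->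
  A *m u = Es i.+2 *m (A *m u) + Es i *m (A *m u).
Proof.
move=> uE; apply/colP=> r; rewrite [RHS]mxE !mul_Estar; set y := enum_val r.
have [dyE|] := boolP ((d x y == i.+2) || (d x y == i)).
  case/orP: dyE => /eqP->; rewrite eqxx; first by rewrite gtn_eqF ?addr0.
  by rewrite ltn_eqF ?add0r.
rewrite negb_or => /andP[d2 d0].
rewrite (negPf d2) (negPf d0) addr0 mul_adj_mx.
apply: big1 => w yw; rewrite -uE mul_Estar enum_rankK; case: eqP => // dw.
have := gdist_step x yw; rewrite ![d _ x]gdist_sym dw eqSS.
by rewrite [i == _]eq_sym (negPf d0) (negPf d2).
Qed.

Variable v : 'cV[C]_#|X|.
Hypotheses (vE : v \in EstarW e x 2 W) (v_neq0 : v != 0).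

Let vW : v \in W. Proof. by have [] := EstarW_P vE. Qed.
Let v2 : Es 2 *m v = v. Proof. by have [] := EstarW_P vE. Qed.

Fixpoint raised (i : nat) : 'cV[C]_#|X| :=
  if i is i'.+1 then Es i'.+3 *m (A *m raised i') else v.

Lemma raised_mem i : raised i \in W.
Proof. by elim: i => //= i IHi; apply/mem_Estar/mem_adj. Qed.

Lemma Estar_raised i j : Es i *m raised j = if i == j.+2 then raised j else 0.
Proof.
case: j => [|j] /=; first by rewrite -[in LHS]v2 EstarM; case: eqP => // ->.
by rewrite EstarM; case: eqP => // ->.
Qed.

Lemma raised_eq0S i : raised i = 0 -> raised i.+1 = 0.
Proof. by move=> /= ->; rewrite !mulmx0. Qed.

(** By thinness the part of [A *m raised i] one step closer to [x] lies on the line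
    through [raised i.-1]; for [i = 0] that part vanishes, and the coefficient is 0. *)
Lemma adj_raised i : exists c, A *m raised i = raised i.+1 + c *: raised i.-1.
Proof.
have := @adj_Estar i.+1 (raised i); rewrite Estar_raised eqxx => -> //.
rewrite -/(raised i.+1); case: i => [|i].
  exists 0; rewrite scale0r [Es 1 *m _]Estar_lt2 //; exact/mem_adj/raised_mem.
have [r0|r0] := eqVneq (raised i) 0.
  by exists 0; rewrite (raised_eq0S r0) !mulmx0 scale0r.
have AW : A *m raised i.+1 \in W by exact/mem_adj/raised_mem.
have [|c ->] := Estar_collinear (i := i.+2) (raised_mem i) AW.
  by rewrite Estar_raised eqxx.
by exists c; rewrite Estar_raised eqxx.
Qed.

(** By [adj_raised] the span on the right is a nonzero submodule of the irreducible
    module [W]. *)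
Lemma raised_span m : raised m = 0 -> W = <<mkseq raised m>>%VS.
Proof.
move=> rm0; set U := (X in _ = X).
have rU j : (j <= m)%N -> raised j \in U.
  rewrite leq_eqVlt => /orP[/eqP->|jm]; first by rewrite rm0 mem0v.
  by apply: memv_span; apply/mapP; exists j; rewrite ?mem_iota.
have UT : Tmodule e x U.
  move=> B; elim=> [|i _|a|M N _ IM _ IN|M N _ IM _ IN] w wU.
  - apply: span_mulmx_stable wU => _ /mapP[j + ->].
    rewrite mem_iota => /andP[_ jm].
    have [c ->] := adj_raised j; rewrite memvD ?memvZ ?rU //.
    exact: leq_trans (leq_pred _) (ltnW jm).
  - apply: span_mulmx_stable wU => _ /mapP[j + ->].
    rewrite mem_iota => /andP[_ jm].
    by rewrite Estar_raised; case: ifP => _; rewrite ?mem0v ?rU // ltnW.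
  - by rewrite mul_scalar_mx memvZ.
  - by rewrite mulmxDl memvD ?IM ?IN.
  - by rewrite -mulmxA IM ?IN.
have UW : (U <= W)%VS.
  by apply/span_subvP=> _ /mapP[j _ ->]; exact: raised_mem.
case: W_irr => _ _ /(_ U UT UW)[U0|<- //].
by have := rU 0%N (leq0n m); rewrite U0 memv0 /= (negPf v_neq0).
Qed.

Lemma dim_raised_span m : raised m = 0 -> (\dim W <= m)%N.
Proof. by move/raised_span->; rewrite (leq_trans (dim_span _)) ?size_mkseq. Qed.

Lemma raisedD : raised D = 0.
Proof.
by rewrite -(prednK D_gt0) /= Estar_gt_diameter // prednK // ltnS leqnSn.
Qed.

Let v_supp z : d x z != 2 -> v (enum_rank z) 0 = 0.
Proof. by move=> dz; rewrite -v2 mul_Estar enum_rankK (negPf dz). Qed.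

(** * The vectors at increasing distance and the action of the projections *)
Definition distance_vec i : 'cV[C]_#|X| := Es (i + 2) *m dist_mx C e i *m v.

Lemma mul_radial_mx g (u : 'cV[C]_#|X|) r :
  (radial_mx g *m u) r 0 = \sum_z (g (d (enum_val r) z))%:C%C * u (enum_rank z) 0.
Proof.
rewrite mxE -sum_enum_val; apply: eq_bigr => s _.
by rewrite mxE enum_valK.
Qed.

Lemma dist_mx_radial i : dist_mx C e i = radial_mx (fun j => (j == i)%:R).
Proof. by apply/matrixP=> r s; rewrite !mxE rmorph_nat. Qed.

(** Let [y] be at distance [i + 3] from [x] and [z] at distance 2. A neighbour of [y]
    at distance [i] from [z] is automatically at distance [i + 2] from [x],
    and it exists only if [y] and [z] are at distance [i + 1]; in that case
    there are [c_(i+1)] of them. *)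
Lemma raise_distance_vec i : (i < D)%N ->
  Es i.+3 *m (A *m distance_vec i) = (cnum i.+1)%:R *: distance_vec i.+1.
Proof.
move=> iD; apply/colP=> r.
rewrite [RHS]mxE /distance_vec addn2 -!mulmxA !mul_Estar; set y := enum_val r.
rewrite addSn addn2; case: eqP => [dy|_]; last by rewrite mulr0.
rewrite mul_adj_mx !dist_mx_radial mul_radial_mx -/y.
pose vx z := v (enum_rank z) 0.
transitivity (\sum_(w | e y w) \sum_z (d w z == i)%:R * vx z).
  apply: eq_bigr => w yw; rewrite mul_Estar enum_rankK mul_radial_mx enum_rankK.
  have yw1 := gdist_edge x yw; case: eqP => [_|dw].
    by apply: eq_bigr => z _; rewrite rmorph_nat.
  rewrite big1 // => z _; rewrite /vx.
  have [dz|/v_supp->] := eqVneq (d x z) 2; last by rewrite mulr0.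
  case: eqP => dwz; last by rewrite mul0r.
  have := gdist_triangle z x w; rewrite dz (gdist_sym z w) dwz.
  by move: yw1 dw; rewrite ![d _ x]gdist_sym dy; lia.
rewrite exchange_big mulr_sumr; apply: eq_bigr => z _.
rewrite -/(vx z) rmorph_nat.
have [dz|/v_supp vz] := eqVneq (d x z) 2; last first.
  by rewrite /vx vz !mulr0 big1 // => w _; rewrite mulr0.
rewrite -mulr_suml mulrA; congr (_ * _); case: eqP => [dyz|dyz].
  rewrite mulr1 -(card_closer iD dyz) -sum1_card natr_sum.
  rewrite [RHS]big_mkcond [LHS]big_mkcond.
  by apply: eq_bigr => w _; rewrite inE; case: (e y w) => //=; case: eqP.
rewrite mulr0 big1 // => w yw; case: eqP => // dwz.
have := gdist_edge z yw; have := gdist_triangle z x y.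
by move: dyz; rewrite dy dz dwz (gdist_sym z y); lia.
Qed.

(** The vector [E_1^* A v] vanishes, and the sum of its entries counts each entry
    of [v] exactly [c_2] times. *)
Lemma sum_coords_eq0 : \sum_z v (enum_rank z) 0 = 0.
Proof.
have Av0 y : e x y -> \sum_(w | e y w) v (enum_rank w) 0 = 0.
  move=> xy.
  have /colP/(_ (enum_rank y)) := Estar_lt2 (isT : (1 < 2)%N) (mem_adj vW).
  by rewrite mul_Estar enum_rankK gdist_eq1 // xy mul_adj_mx enum_rankK mxE.
have c2_neq0 : (cnum 2)%:R != 0 :> C.
  by rewrite pnatr_eq0 -lt0n (cnum_gt0 x) // (leq_trans _ D_ge4).
apply: (mulfI c2_neq0); rewrite mulr0.
transitivity (\sum_(y | e x y) \sum_(w | e y w) v (enum_rank w) 0);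
  last exact: big1.
rewrite mulr_sumr (exchange_big_dep predT) //=; apply: eq_bigr => w _.
have [dw|/v_supp->] := eqVneq (d x w) 2; last by rewrite mulr0 big1.
rewrite -(card_closer _ dw) ?(leq_trans _ D_ge4) // -sum1_card natr_sum mulr_suml.
by apply: eq_big => [u|u _]; rewrite ?inE ?gdist_eq1 ?mul1r.
Qed.

(** Distances between vertices of the second subconstituent are 0, 2 or 4, so an
    entry of [E_j v] there is [(f0 - f4)] times that of [v], plus [(f2 - f4)]
    times that of [A_2 v], plus [f4] times the sum of all the entries of [v]. *)
Lemma Estar_proj n j : local_eigenvalue e x W (local_theta n)%:C%C ->
  Es 2 *m (Eproj (val (j : 'I_D.+1)) *m v) = (local_ratio n j)%:C%C *: v.
Proof.
move=> hloc; have A2v := hloc v vE.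
apply/colP=> r; rewrite mul_Estar [RHS]mxE; set y := enum_val r.
case: eqP => [dy|/eqP/v_supp]; last by rewrite enum_valK => ->; rewrite mulr0.
rewrite fE mul_radial_mx -/y.
have A2vr : \sum_z (d y z == 2)%:R * v (enum_rank z) 0 =
            (local_theta n)%:C%C * v r 0.
  have /colP/(_ r) := A2v; rewrite -!mulmxA v2 mul_Estar -/y dy eqxx [RHS]mxE => <-.
  rewrite dist_mx_radial mul_radial_mx; apply: eq_bigr => z _.
  by rewrite rmorph_nat.
rewrite (eq_bigr (fun z =>
  (f j 0%N - f j 4)%:C%C * ((d y z == 0)%:R * v (enum_rank z) 0)
  + (f j 2 - f j 4)%:C%C * ((d y z == 2)%:R * v (enum_rank z) 0)
  + (f j 4)%:C%C * v (enum_rank z) 0)).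
  rewrite !big_split /= -!mulr_sumr A2vr sum_coords_eq0 mulr0 addr0.
  rewrite (bigD1 y) //= gdistxx // eqxx mul1r enum_valK big1 ?addr0; last first.
    by move=> z zy; rewrite gdist_eq0 // eq_sym (negPf zy) mul0r.
  rewrite /local_ratio.
  move: (local_theta n) (f j 0%N - f j 4) (f j 2 - f j 4) => lt c0 c2.
  by rewrite rmorphD rmorphM /= mulrDl -mulrA.
move=> z _; have [dz|/v_supp->] := eqVneq (d x z) 2; last first.
  by rewrite !mulr0 !addr0.
have := odd_gdist x y z; rewrite dy dz addbb.
have := gdist_triangle x y z; rewrite (gdist_sym y x) dy dz addnn.
case: (d y z) => [|[|[|[|[|[]]]]]] //= _ _;
  rewrite !(mul0r, mulr0, mul1r, addr0, add0r) //.
- by rewrite rmorphB /=; ring.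
- by rewrite rmorphB /=; ring.
Qed.

Lemma radial_mx_hermitian g : map_mx Num.conj (radial_mx g)^T = radial_mx g.
Proof.
apply/matrixP=> r s; rewrite !mxE gdist_sym; apply/conj_Creal.
by rewrite complex_real.
Qed.

(** If the ratio is 0, then [E_j v] vanishes on the support of [v], so it is
    orthogonal to [v]; as [E_j] is a Hermitian idempotent, that inner product is the
    squared norm of [E_j v]. *)
Lemma Eproj_eq0 n j :
  admissible n -> local_eigenvalue e x W (local_theta n)%:C%C ->
  (Eproj (val (j : 'I_D.+1)) *m v == 0) = (val j \in [:: 0; D; n; D - n]%N).
Proof.
move=> adm hloc; rewrite -(local_ratio_eq0 x) //; have E2 := Estar_proj j hloc.
apply/eqP/eqP=> [Ej0|rho0].
  move: E2; rewrite Ej0 mulmx0 => /esym/eqP.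
  by rewrite scaler_eq0 (negPf v_neq0) orbF; move=> /eqP/complexI.
move: E2; rewrite rho0 scale0r; set u := _ *m v => u2.
pose vs := map_mx Num.conj v^T; pose us := map_mx Num.conj u^T.
have usE : us = vs *m Eproj j.
  by rewrite /us /u trmx_mul map_mxM fE radial_mx_hermitian.
have EE : Eproj j *m Eproj j = Eproj j.
  rewrite /Eproj eigenprojM ?eqxx ?leq_ord //; first exact: adj_mx_normal.
  exact: thetaE.2.
have uu0 : (us *m u) 0 0 = 0.
  rewrite usE -mulmxA [X in _ *m X]mulmxA EE -/u mxE big1 // => r _.
  have [dr|nr] := eqVneq (d x (enum_val r)) 2.
    have /colP/(_ r) := u2; rewrite mul_Estar dr eqxx [RHS]mxE => ->.
    by rewrite mulr0.
  by rewrite !mxE -(enum_valK r) v_supp // conjC0 mul0r.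
apply/colP=> r; rewrite [RHS]mxE; apply/eqP; rewrite -normr_eq0 -sqrf_eq0.
have : \sum_s `|u s 0| ^+ 2 = (us *m u) 0 0.
  by rewrite [RHS]mxE; apply: eq_bigr => s _; rewrite !mxE normCKC.
by rewrite uu0 => /psumr_eq0P-> // s _; rewrite exprn_ge0.
Qed.

(** * The dimension of the module and the basis *)
Variable n : nat.
Hypothesis n_adm : admissible n.
Hypothesis W_loc : local_eigenvalue e x W (local_theta n)%:C%C.

(** The eigenvalues of [A] on [W] are the [theta j] with [j] in this list. *)
Definition eigen_indices :=
  [seq j <- iota 0 D.+1 | j \notin [:: 0; D; n; D - n]%N].

Lemma mem_eigen_indices (j : 'I_D.+1) :
  (val j \in eigen_indices) = (Eproj j *m v != 0).
Proof.
rewrite (Eproj_eq0 _ n_adm W_loc) mem_filter mem_iota leq0n ltn_ord /=.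
by rewrite andbT.
Qed.

Lemma eigen_indicesP j : j \in eigen_indices -> (j <= D)%N /\ Eproj j *m v != 0.
Proof.
move=> jS; have jD : (j < D.+1)%N.
  by move: jS; rewrite mem_filter mem_iota => /andP[].
by rewrite -ltnS jD -(mem_eigen_indices (Ordinal jD)).
Qed.

Lemma size_eigen_indices : size eigen_indices = (D - 3)%N.
Proof.
set t := [:: 0; D; n; D - n]%N.
have [/andP[n0 nD] nDn] := admissible_bounds n_adm.
have t_uniq : uniq t.
  by rewrite /= !inE !negb_or !andbT; move: D_ge4 n0 nD nDn; clear; lia.
have : count (mem t) (iota 0 D.+1) = 4.
  rewrite -size_filter; apply: (perm_size (s2 := t)); apply: uniq_perm => //.
    by rewrite filter_uniq ?iota_uniq.
  move=> j; rewrite mem_filter mem_iota andb_idr //= add0n.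
  by rewrite !inE => /or4P[]/eqP-> //; rewrite ltnS ?(ltnW nD) ?leq_subr.
have := count_predC (mem t) (iota 0 D.+1); rewrite size_iota size_filter => + c4.
by rewrite c4 (eq_count (a2 := fun j => j \notin t)) // => ?; lia.
Qed.

Lemma free_eigenvectors : free [seq Eproj j *m v | j <- eigen_indices].
Proof.
apply: (free_separated (p := fun j => linfun (mulmx (Eproj j)))).
- by rewrite filter_uniq ?iota_uniq.
- move=> i /eigen_indicesP[iD Ei]; rewrite lfunE /= mulmxA /Eproj.
  by rewrite (eigenprojM adj_mx_normal injC thetaE.2) // eqxx.
- move=> i j /eigen_indicesP[iD _] /eigen_indicesP[jD _] /negPf ij.
  rewrite lfunE /= mulmxA /Eproj.
  by rewrite (eigenprojM adj_mx_normal injC thetaE.2) // ij mul0mx.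
Qed.

Lemma Eproj_mem j : Eproj j *m v \in W.
Proof.
apply: (@eigenproj_ind _ _ _ _ _ (fun M => M *m v \in W)); first by rewrite mul1mx.
move=> i l M MW; rewrite -scalemxAl memvZ // mulmxBl -mulmxA -scalemxAl.
by rewrite memvB ?memvZ ?mem_adj.
Qed.

Lemma dim_span_eigenvectors :
  \dim <<[seq Eproj j *m v | j <- eigen_indices]>> = (D - 3)%N.
Proof. by rewrite (eqP free_eigenvectors) size_map size_eigen_indices. Qed.

(** The span on the right contains [v], the sum of all its components [E_j v], and
    is stable under [A]; it therefore contains the vectors [raised i] that
    span [W]. *)
Lemma module_eigenbasis : W = <<[seq Eproj j *m v | j <- eigen_indices]>>%VS.
Proof.
set K := (X in _ = X); apply/eqP; rewrite eqEsubv; apply/andP; split; last first.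
  by apply/span_subvP=> _ /mapP[j _ ->]; exact: Eproj_mem.
have EK (j : 'I_D.+1) : Eproj j *m v \in K.
  have [->|Ej] := eqVneq (Eproj j *m v) 0; first exact: mem0v.
  by apply/memv_span/mapP; exists (val j); rewrite ?mem_eigen_indices.
have vK : v \in K.
  have /(congr1 (mulmx^~ v)) := sum_eigenproj adj_mx_normal injC thetaE.2.
  by rewrite mul1mx => <-; rewrite mulmx_suml memv_suml // => j _; exact: EK.
have AK u : u \in K -> A *m u \in K.
  apply: span_mulmx_stable => _ /mapP[j /eigen_indicesP[jD _] ->].
  rewrite mulmxA /Eproj (mul_eigenproj adj_mx_normal injC thetaE.2) //.
  rewrite -scalemxAl memvZ //.
  exact: (EK (Ordinal (jD : j < D.+1)%N)).
have rK i : raised i \in K /\ raised i.+1 \in K.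
  elim: i => [|i [rK0 rK1]]; split=> //.
    have [c E] := adj_raised 0.
    rewrite -[raised 1](addrK (c *: raised 0)) -[X in X - _]E.
    by rewrite memvB ?memvZ ?AK.
  have [c E] := adj_raised i.+1.
  rewrite -[raised i.+2](addrK (c *: raised i)) -[X in X - _]E.
  by rewrite memvB ?memvZ ?AK.
rewrite (raised_span raisedD); apply/span_subvP=> _ /mapP[i _ ->].
by have [] := rK i.
Qed.

Lemma dim_W : \dim W = (D - 3)%N.
Proof. by rewrite module_eigenbasis dim_span_eigenvectors. Qed.

(** If [raised i] were 0, then [W] would be spanned by [i] vectors, fewer than its
    dimension. *)
Lemma raised_neq0 i : (i <= D - 4)%N -> raised i != 0.
Proof.
move=> iD; apply/eqP=> /dim_raised_span; rewrite dim_W.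
by move: iD D_ge4; clear; lia.
Qed.

Lemma raised_distance_vec i : (i <= D - 4)%N ->
  exists2 g : C, g != 0 & raised i = g *: distance_vec i.
Proof.
elim: i => [_|i IHi iD].
  exists 1; rewrite ?oner_eq0 // scale1r /distance_vec add0n.
  suff -> : dist_mx C e 0 = 1%:M by rewrite mulmx1 v2.
  by rewrite dist_mx_radial radial_mx1.
have [g g0 /= ->] := IHi (ltnW iD).
exists (g * (cnum i.+1)%:R).
  rewrite mulf_neq0 // pnatr_eq0 -lt0n (cnum_gt0 x) //.
  by move: iD D_ge4; clear; lia.
rewrite -!scalemxAr raise_distance_vec ?scalerA //.
by move: iD D_ge4; clear; lia.
Qed.

Lemma raised_distance_basis : basis_of W [seq distance_vec i | i <- iota 0 (D - 4).+1].
Proof.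
have fv i : i \in iota 0 (D - 4).+1 -> distance_vec i \in W /\ distance_vec i != 0.
  rewrite mem_iota ltnS => /andP[_ iD]; have [g g0 rE] := raised_distance_vec iD.
  split; last by have := raised_neq0 iD; rewrite rE scaler_eq0 negb_or => /andP[].
  by rewrite -(scalerK g0 (distance_vec i)) -rE memvZ ?raised_mem.
rewrite basisEfree size_map size_iota dim_W; apply/and3P; split.
- apply: (free_separated (p := fun i => linfun (mulmx (Es (i + 2)%N)))).
  + exact: iota_uniq.
  + by move=> i /fv[_ ?]; rewrite lfunE /= /distance_vec -mulmxA EstarM eqxx mulmxA.
  + move=> i j _ _ ij; rewrite lfunE /= /distance_vec -mulmxA EstarM eqn_add2r.
    by rewrite (negPf ij).
- by apply/span_subvP=> _ /mapP[i /fv[? _] ->].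
- by move: D_ge4; clear; lia.
Qed.

End Module.
End Radial.
End Graph.

Theorem theorem13p3 (R : realType) (X : finType) (e : rel X) (D : nat)
    (theta : nat -> R) (x : X) (n : nat)
    (W : {vspace 'cV[R[i]]_#|X|}) (v : 'cV[R[i]]_#|X|)
    (hsimple : simple_graph e) (hconn : connected_graph e)
    (hbip : bipartite e) (hdr : distance_regular e)
    (hdiam : diameter e = D) (hD : (4 <= D)%N)
    (hk : (3 <= valency e)%N)
    (htheta : ordered_eigenvalues (adj_mx R[i] e) D theta)
    (hn : if odd D then n = 1%N \/ n = D./2 else n = 1%N)
    (hirr : irreducible_Tmodule e x W) (hthin : thin e x W)
    (hend : has_endpoint e x W 2)
    (hloc : local_eigenvalue e x W
       (- 1 - (bnum e 2 * bnum e 3)%:R / (theta n ^+ 2 - (bnum e 2)%:R))%:C%C)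
    (hv : v \in EstarW e x 2 W) (hv0 : v <> 0) :
  basis_of W
    [seq Estar R[i] e x (i + 2) *m dist_mx R[i] e i *m v
       | i <- iota 0 (D - 4).+1].
Proof.
case: hsimple => symE irrE; move: hloc; rewrite natrM => hloc.
subst D; have D_gt0 : (0 < diameter e)%N by exact: leq_trans hD.
have [f fE] := Eproj_radial irrE hconn hdr D_gt0 theta.
exact: (raised_distance_basis symE irrE hconn hbip hdr D_gt0 htheta fE hD hk
  hirr hthin hend hv (introN eqP hv0) hn hloc).
Qed.
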